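(* The quasi-monotonic functions are precisely the functions of the form $d_\alpha u_\beta$: a function $f:[n]\to[m]$ is quasi-monotonic if and only if $f=d_\alpha u_\beta$ for some multi-indices $\alpha$ (of dimension $\le m$) and $\beta$ (of dimension $\le n$) with $n-|\beta|=m-|\alpha|$.
   Context: For $n\ge0$, $[n]=\{0,1,\dots,n\}$. Products denote ordinary composition of functions (the rightmost factor is applied first). A function $f:[n]\to[m]$ is quasi-monotonic if (QM1) $f(0)=0$, and (QM2) whenever $f(p)\ne0\ne f(q)$ and $p<q$, then $f(p)<f(q)$. $d_i:[n-1]\to[n]$ ($n\ge1$, $0\le i\le n$) is $k\mapsto k$ for $k<i$, $k\mapsto k+1$ for $k\ge i$. $u_i:[n+1]\to[n]$ ($n\ge0$, $1\le i\le n+1$) is $0\mapsto0$, $i\mapsto0$, $k\mapsto k$ for $1\le k\le i-1$, $k\mapsto k-1$ for $k>i$. A multi-index $\alpha$ of length $k\ge0$ and dimension $\le n$ is a strictly increasing sequence $i_1<\dots<i_k$ with $1\le i_p\le n$; $|\alpha|=k$. Set $u_\alpha=u_{i_1}u_{i_2}\cdots u_{i_k}:[n]\to[n-|\alpha|]$ and $d_\alpha=d_{i_k}d_{i_{k-1}}\cdots d_{i_1}:[n-|\alpha|]\to[n]$ (both are the identity for empty $\alpha$). *)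

(* Defs.v *)
From HB Require Import structures.
From mathcomp Require Import all_boot.

Set Implicit Arguments.
Unset Strict Implicit.
Unset Printing Implicit Defensive.

(* The set [n] = {0, 1, ..., n} is the ordinal type 'I_n.+1. *)

Definition quasi_monotonic (n m : nat) (f : 'I_n.+1 -> 'I_m.+1) : Prop :=
  f ord0 = ord0 /\
  (forall p q : 'I_n.+1, f p <> ord0 -> f q <> ord0 -> p < q -> f p < f q).

(* d_i : [n-1] -> [n] and u_i : [n] -> [n-1], both indexed by n, for n >= 1
   and i in the respective ranges 0 <= i <= n and 1 <= i <= n; there [inord]
   truncates nothing (see [dmapE] and [umapE]).  The case n = 0 is junk. *)

Definition dmap (n i : nat) (k : 'I_n.-1.+1) : 'I_n.+1 :=
  inord (if k < i then k : nat else k.+1).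

Definition umap (n i : nat) (k : 'I_n.+1) : 'I_n.-1.+1 :=
  inord (if (k == 0 :> nat) || (k == i :> nat) then 0
         else if k < i then k : nat else k.-1).

Lemma dmapE n i (k : 'I_n.-1.+1) : 0 < n ->
  dmap i k = (if k < i then k : nat else k.+1) :> nat.
Proof.
case: n k => // n k _; rewrite inordK //.
by case: ifP => _; rewrite ltnS ?ltn_ord // ltnW // ltn_ord.
Qed.

Lemma umapE n i (k : 'I_n.+1) : 0 < i <= n ->
  umap i k = (if (k == 0 :> nat) || (k == i :> nat) then 0
              else if k < i then k : nat else k.-1) :> nat.
Proof.
case: n k => [|n] k; first by case: i.
case/andP=> i_gt0 i_le; rewrite inordK //=; case: ifP => //.
case: k => [[|k] //= k_lt] _; case: ifP => // /leq_trans -> //.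
Qed.

(* A multi-index of dimension <= n; its length |alpha| is [size alpha]. *)
Record multi_index (n : nat) := MultiIndex {
  indices :> seq nat;
  indices_increasing : sorted ltn indices;
  indices_range : all (fun i => 0 < i <= n) indices
}.

Lemma size_multi_index n (alpha : multi_index n) : size alpha <= n.
Proof.
case: alpha => s /= s_lt /allP s_range.
rewrite -[leqRHS](size_iota 1); apply: uniq_leq_size => [|i /s_range].
  exact: (sorted_uniq ltn_trans ltnn).
by rewrite mem_iota add1n ltnS.
Qed.

(* The casts below only identify the types of equal bounds n - 0 = n and
   n - k.+1 = (n - k).-1; they do not change the value of an ordinal. *)

(* u_[:: i_1; ...; i_k] = u_{i_1} o u_{i_2} o ... o u_{i_k}, with u_{i_k}
   applied first; the leftmost factor goes from [n-k+1] to [n-k]. *)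
Fixpoint umulti (n : nat) (s : seq nat) : 'I_n.+1 -> 'I_(n - size s).+1 :=
  match s return 'I_n.+1 -> 'I_(n - size s).+1 with
  | [::] => cast_ord (congr1 S (esym (subn0 n)))
  | i :: s' => fun x =>
      cast_ord (congr1 S (esym (subnS n (size s')))) (umap i (@umulti n s' x))
  end.

(* d_[:: i_1; ...; i_k] = d_{i_k} o ... o d_{i_2} o d_{i_1}, with d_{i_1}
   applied first; this rightmost factor goes from [n-k] to [n-k+1]. *)
Fixpoint dmulti (n : nat) (s : seq nat) : 'I_(n - size s).+1 -> 'I_n.+1 :=
  match s return 'I_(n - size s).+1 -> 'I_n.+1 with
  | [::] => cast_ord (congr1 S (subn0 n))
  | i :: s' => fun x =>
      @dmulti n s' (dmap i (cast_ord (congr1 S (subnS n (size s'))) x))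
  end.

Definition u_ (n : nat) (beta : multi_index n) :
  'I_n.+1 -> 'I_(n - size beta).+1 := @umulti n beta.

Definition d_ (n : nat) (alpha : multi_index n) :
  'I_(n - size alpha).+1 -> 'I_n.+1 := @dmulti n alpha.

Arguments u_ {n} beta _.
Arguments d_ {n} alpha _.

(* Main.v *)
Require Import Defs.
From HB Require Import structures.
From mathcomp Require Import all_boot.

Set Implicit Arguments.
Unset Strict Implicit.
Unset Printing Implicit Defensive.

(** Quasi-monotonic functions fix 0, so a point with nonzero image is itself
nonzero; hence they are closed under composition, and every [d_alpha u_beta] is
quasi-monotonic because its factors are ([quasi_monotonic_d_],
[quasi_monotonic_u_]).

Conversely, a quasi-monotonic [f] restricts to an increasing bijection from
[A = {x | f x <> 0}] onto [B = f(A)].  Take for [beta] and [alpha] the nonzero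
indices outside [A] and outside [B].  Since [u_beta] kills the complement of [A]
and sends an element of [A] to its rank in [A] ([u_gapsE]), and [f] preserves
ranks, [u_alpha (f x)] and [u_beta x] are equal.  Applying [d_alpha], which
inverts [u_alpha] off [alpha] ([u_K]), gives [f = d_alpha u_beta]; the sizes
match because [n - |beta| = |A| = |B| = m - |alpha|]. *)

Lemma quasi_monotonic_comp n m p (g : 'I_m.+1 -> 'I_p.+1)
    (f : 'I_n.+1 -> 'I_m.+1) :
  quasi_monotonic g -> quasi_monotonic f -> quasi_monotonic (g \o f).
Proof.
move=> [g0 g_lt] [f0 f_lt]; split=> [|x y /= gfx gfy lt_xy].
  by rewrite /= f0.
by apply: g_lt => //; apply: f_lt => // fz; [apply: gfx | apply: gfy]; rewrite fz.
Qed.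

Lemma quasi_monotonic_cast n m (e : n = m) :
  quasi_monotonic (cast_ord (congr1 S e)).
Proof. by split=> //; apply: val_inj. Qed.

Lemma quasi_monotonic_dmap n i : 0 < i <= n -> quasi_monotonic (@dmap n i).
Proof.
move=> /andP[i_gt0 le_in]; have n_gt0 := leq_trans i_gt0 le_in.
split=> [|x y _ _ lt_xy]; first by apply: val_inj; rewrite /= dmapE ?i_gt0.
rewrite !dmapE //; case: (ltnP x i) (ltnP y i) => [lt_xi|le_ix] [lt_yi|le_iy] //.
  exact: ltnW.
by have := leq_trans lt_yi (leq_trans le_ix (ltnW lt_xy)); rewrite ltnn.
Qed.

Lemma quasi_monotonic_umap n i : 0 < i <= n -> quasi_monotonic (@umap n i).
Proof.
move=> i_range; split=> [|x y]; first by apply: val_inj; rewrite /= umapE.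
have nz z : umap i z <> ord0 -> (umap i z : nat) <> 0.
  by move=> uz uz0; apply: uz; apply: val_inj.
move=> /nz + /nz; rewrite !umapE //.
case: eqP => //= x0; case: eqP => //= xi _.
case: eqP => //= y0; case: eqP => //= yi _.
move=> lt_xy; case: (ltnP x i) (ltnP y i) => [lt_xi|le_ix] [lt_yi|le_iy] //.
- have lt_iy : i < y by rewrite ltn_neqAle le_iy andbT eq_sym; apply/eqP.
  by apply: leq_trans lt_xi _; rewrite -ltnS prednK // (leq_trans _ lt_iy).
- by have := leq_trans lt_yi (leq_trans le_ix (ltnW lt_xy)); rewrite ltnn.
- by rewrite -ltnS !prednK // lt0n; apply/eqP.
Qed.

(** The entries of [s] are distinct, above [i] and at most [n], so [i] does not exceed
[n - size s]: the outermost factor of a multi-index is a genuine [d_i] or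
[u_i], within the range of indices where these are meaningful. *)
Lemma head_range n i s :
  sorted ltn (i :: s) -> all (fun j => 0 < j <= n) (i :: s) ->
  0 < i <= n - size s.
Proof.
move=> s_lt /= /andP[/andP[i_gt0 le_in] /allP s_range]; rewrite i_gt0 /=.
have /allP s_gt := order_path_min ltn_trans s_lt.
have: size s <= size (iota i.+1 (n - i)).
  apply: uniq_leq_size => [|j js].
    exact: (sorted_uniq ltn_trans ltnn (path_sorted s_lt)).
  rewrite mem_iota addSn subnKC // ltnS.
  by case/andP: (s_range j js) => _ ->; rewrite andbT; exact: s_gt.
rewrite size_iota => le_s.
have le_sn : size s <= n := leq_trans le_s (leq_subr _ _).
by rewrite leq_subRL // addnC -leq_subRL.
Qed.

(** Induction on multi-indices, adding entries at the front.  The predicate is on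
sequences, like [umulti] and [dmulti], so it makes sense of [i :: s] without a
proof that this is again a multi-index. *)
Lemma multi_index_ind_seq n (P : seq nat -> Prop) :
  P [::] ->
  (forall i (s : multi_index n), 0 < i <= n - size s -> all (ltn i) s ->
     P s -> P (i :: s)) ->
  forall s : multi_index n, P s.
Proof.
move=> P0 PS [s s_lt s_range] /=; elim: s s_lt s_range => // i s IHs s_lt s_range.
have s_lt' := path_sorted s_lt; have /= /andP[_ s_range'] := s_range.
apply: (PS i (MultiIndex s_lt' s_range')) => /=.
- exact: head_range s_lt s_range.
- exact: order_path_min ltn_trans s_lt.
- exact: IHs.
Qed.

Lemma quasi_monotonic_u_ n (beta : multi_index n) : quasi_monotonic (u_ beta).
Proof.
apply: (multi_index_ind_seq
    (P := fun s => quasi_monotonic (@umulti n s))) => [|i s i_range _ IHs].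
  exact: (quasi_monotonic_cast (esym (subn0 n))).
exact: quasi_monotonic_comp (quasi_monotonic_cast (esym (subnS n (size s))))
  (quasi_monotonic_comp (quasi_monotonic_umap i_range) IHs).
Qed.

Lemma quasi_monotonic_d_ n (alpha : multi_index n) : quasi_monotonic (d_ alpha).
Proof.
apply: (multi_index_ind_seq
    (P := fun s => quasi_monotonic (@dmulti n s))) => [|i s i_range _ IHs].
  exact: (quasi_monotonic_cast (subn0 n)).
exact: quasi_monotonic_comp IHs
  (quasi_monotonic_comp (quasi_monotonic_dmap i_range)
    (quasi_monotonic_cast (subnS n (size s)))).
Qed.

Lemma notin_gt i k (s : seq nat) : all (ltn i) s -> k <= i -> k \notin s.
Proof.
by move=> s_gt le_ki; apply/negP => /(allP s_gt) /=; rewrite ltnNge le_ki.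
Qed.

Lemma count_gt i k (s : seq nat) :
  all (ltn i) s -> k <= i -> count [predC (s : seq nat)] (iota 1 k) = k.
Proof.
move=> s_gt le_ki; rewrite -[RHS](size_iota 1) -count_predT.
apply: eq_in_count => j; rewrite mem_iota add1n ltnS => /andP[_ le_jk].
by rewrite /= (notin_gt s_gt) // (leq_trans le_jk).
Qed.

(** Off [beta], [u_beta x] is the number of survivors among [1, ..., x].  When
[u_i] is composed on top of [u_s], where [i] precedes all of [s], nothing below
or at [i] has been removed yet; so the value of [u_s x] is on the same side of
[i] as [x] itself, and [u_i] decrements it exactly when [i] is one of the
[1, ..., x]. *)
Lemma u_E n (beta : multi_index n) (x : 'I_n.+1) :
  u_ beta x =
    (if (x : nat) \in (beta : seq nat) then 0
     else count [predC (beta : seq nat)] (iota 1 x)) :> nat.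
Proof.
move: x; apply: (multi_index_ind_seq (P := fun s => forall x : 'I_n.+1, umulti s x =
  (if (x : nat) \in s then 0 else count [predC (s : seq nat)] (iota 1 x)) :> nat)) =>
   [x|i s i_range s_gt IHs x] /=.
  by rewrite /= (eq_count (a2 := predT)) ?count_predT ?size_iota.
have /andP[i_gt0 _] := i_range; rewrite umapE // {}IHs inE.
have notin_s k := notin_gt s_gt (k := k).
have count_low k := count_gt s_gt (k := k).
have count_rem : count [predC (s : seq nat)] (iota 1 x) =
    (0 < i <= x) + count [predC i :: (s : seq nat)] (iota 1 x).
  rewrite -[X in X + _](_ : count_mem i (iota 1 x) = _); last first.
    by rewrite count_uniq_mem ?iota_uniq // mem_iota add1n ltnS.
  rewrite -count_predUI [X in _ + X](_ : _ = 0) ?addn0.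
    apply: eq_count => k; rewrite /= inE; case: eqP => [->|//] /=.
    by rewrite notin_s.
  apply/eqP; rewrite -leqn0 leqNgt -has_count; apply/hasPn => k _ /=.
  by rewrite inE; case: eqP.
case: (ltngtP x i) => [lt_xi | lt_ix | eq_xi] /=.
- have := count_rem; rewrite (negbTE (notin_s _ (ltnW lt_xi))).
  rewrite (count_low x) ?(ltnW lt_xi) //.
  rewrite [i <= x]leqNgt lt_xi andbF add0n => <-.
  by rewrite (ltn_eqF lt_xi) orbF; case: eqP.
- case: (boolP ((x : nat) \in (s : seq nat))) => xs //=; move: count_rem.
  have lt_ic : i < count [predC (s : seq nat)] (iota 1 x).
    rewrite -(subnKC lt_ix) addSnnS iotaD count_cat count_low //.
    rewrite -[ltnLHS]addn0 ltn_add2l -has_count; apply/hasP; exists (x : nat) => //.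
    by rewrite mem_iota add1n lt_ix addnS subnKC // leqnn.
  rewrite i_gt0 (ltnW lt_ix) add1n => eq_c.
  rewrite gtn_eqF ?(leq_trans _ lt_ic) //.
  by rewrite gtn_eqF // ltnNge (ltnW lt_ic) /= eq_c.
- by rewrite eq_xi (negbTE (notin_s i _)) // count_low // eqxx orbT.
Qed.

Lemma umapK n i (y : 'I_n.+1) :
  0 < i <= n -> y != i :> nat -> dmap i (umap i y) = y.
Proof.
move=> i_range ne_yi; have /andP[i_gt0 le_in] := i_range; apply: val_inj.
rewrite /= dmapE ?(leq_trans i_gt0) // umapE // (negbTE ne_yi) orbF.
case: (posnP y) => [-> | y_gt0]; first by rewrite i_gt0.
case: (ltnP y i) => [-> // | le_iy]; rewrite prednK //.
by rewrite leqNgt ltn_neqAle eq_sym ne_yi le_iy.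
Qed.

(** Each layer cancels by [umapK], provided the value reaching [u_i] is not [i];
by induction that value is [i] only at the point [i] itself. *)
Lemma u_K n (alpha : multi_index n) (x : 'I_n.+1) :
  (x : nat) \notin (alpha : seq nat) -> d_ alpha (u_ alpha x) = x.
Proof.
move: x; apply: (multi_index_ind_seq (P := fun s => forall x : 'I_n.+1,
    (x : nat) \notin s -> dmulti (umulti s x) = x)) =>
   [x _|i s i_range s_gt IHs x].
  by apply: val_inj.
rewrite inE negb_or => /andP[ne_xi xs] /=; have /andP[_ le_in] := i_range.
rewrite cast_ord_comp cast_ord_id umapK ?IHs //.
have lt_in : i < n.+1 by rewrite ltnS (leq_trans le_in) ?leq_subr.
have is_ : i \notin (s : seq nat) by exact: notin_gt s_gt (leqnn i).
(* [u_s] fixes [i], and it is injective off [s] since [d_s] inverts it there. *)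
have ui : umulti s (Ordinal lt_in) = i :> nat.
  by rewrite [LHS]u_E /= (negbTE is_) (count_gt s_gt).
apply: contra ne_xi => /eqP eq_i; apply/eqP.
have eq_u : umulti s x = umulti s (Ordinal lt_in).
  by apply: val_inj; rewrite /= ui.
by rewrite -(IHs x xs) eq_u IHs.
Qed.

(** A multi-index is read as the complement of the set of points that [u_]
keeps and that [d_] reaches, 0 aside. *)
Definition gaps_seq n (A : {set 'I_n.+1}) : seq nat :=
  [seq i <- iota 1 n | inord i \notin A].

Lemma gaps_increasing n (A : {set 'I_n.+1}) : sorted ltn (gaps_seq A).
Proof. exact: (sorted_filter ltn_trans _ (iota_ltn_sorted _ _)). Qed.

Lemma gaps_range n (A : {set 'I_n.+1}) :
  all (fun i => 0 < i <= n) (gaps_seq A).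
Proof.
by apply/allP => i; rewrite mem_filter mem_iota add1n ltnS => /andP[].
Qed.

Definition gaps n (A : {set 'I_n.+1}) : multi_index n :=
  MultiIndex (gaps_increasing A) (gaps_range A).

Lemma mem_gaps n (A : {set 'I_n.+1}) (x : 'I_n.+1) :
  ((x : nat) \in (gaps A : seq nat)) = (0 < x) && (x \notin A).
Proof.
by rewrite mem_filter mem_iota inord_val add1n ltn_ord andbT andbC.
Qed.

Lemma count_iota_card n (A : {set 'I_n.+1}) k : ord0 \notin A -> k <= n ->
  count (fun i => inord i \in A) (iota 1 k) = #|[set x in A | x <= k]|.
Proof.
move=> A0 le_kn; rewrite cardE size_filter -enumT.
have -> : count (mem [set x in A | x <= k]) (enum 'I_n.+1)
    = count (fun i => (inord i \in A) && (i <= k)) (iota 0 n.+1).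
  rewrite -val_enum_ord count_map; apply: eq_count => x /=.
  by rewrite !inE inord_val.
have inord0 : inord 0 = ord0 :> 'I_n.+1 by apply: val_inj; rewrite /= inordK.
rewrite /= inord0 (negbTE A0) add0n -[in iota 1 n](subnKC le_kn) iotaD count_cat.
rewrite [X in _ = _ + X](_ : _ = 0) ?addn0.
  apply: eq_in_count => i; rewrite mem_iota add1n ltnS => /andP[_ ->].
  by rewrite andbT.
apply/eqP; rewrite -leqn0 leqNgt -has_count; apply/hasPn => i.
by rewrite mem_iota add1n => /andP[lt_ki _]; rewrite leqNgt lt_ki andbF.
Qed.

Lemma size_gaps n (A : {set 'I_n.+1}) : ord0 \notin A -> n - size (gaps A) = #|A|.
Proof.
move=> A0; rewrite size_filter -[X in X - _](size_iota 1).
rewrite -(count_predC (fun i => inord i \in A)) addnK count_iota_card //.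
by apply: eq_card => x; rewrite !inE -ltnS ltn_ord andbT.
Qed.

Lemma u_gapsE n (A : {set 'I_n.+1}) (x : 'I_n.+1) : ord0 \notin A ->
  u_ (gaps A) x = (if x \in A then #|[set y in A | y <= x]| else 0) :> nat.
Proof.
move=> A0; rewrite u_E mem_gaps; case: (posnP x) => [x0|_] /=.
  have ->: x = ord0 by apply: val_inj.
  by rewrite (negbTE A0).
case: ifP => [/negbTE-> // | /negbFE xA]; rewrite xA -count_iota_card -1?ltnS //.
apply: eq_in_count => i; rewrite mem_iota add1n ltnS => /andP[i_gt0 le_ix].
have lt_in : i < n.+1 := leq_ltn_trans le_ix (ltn_ord x).
by have := mem_gaps A (inord i); rewrite inordK // i_gt0 /= => ->; rewrite negbK.
Qed.

Theorem mainTheorem3 (n m : nat) (f : 'I_n.+1 -> 'I_m.+1) :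
  quasi_monotonic f <->
  exists (alpha : multi_index m) (beta : multi_index n)
         (e : n - size beta = m - size alpha),
    f =1 (fun x => d_ alpha (cast_ord (congr1 S e) (u_ beta x))).
Proof.
split=> [[f0 f_lt] | [alpha [beta [e def_f]]]]; last first.
  have [g0 g_lt] := quasi_monotonic_comp (quasi_monotonic_d_ alpha)
    (quasi_monotonic_comp (quasi_monotonic_cast e) (quasi_monotonic_u_ beta)).
  by split=> [|p q]; rewrite !def_f //; exact: g_lt.
set A := [set x | f x != ord0]; set B := f @: A.
have A0 : ord0 \notin A by rewrite inE f0 eqxx.
have B0 : ord0 \notin B.
  by apply/imsetP => -[x]; rewrite inE => /eqP fx /esym.
have fA_lt : {in A &, forall x y : 'I_n.+1, x < y -> f x < f y}.
  by move=> x y; rewrite !inE => /eqP fx /eqP fy; exact: f_lt.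
have fA_le : {in A &, forall x y : 'I_n.+1, (f x <= f y) = (x <= y)}.
  move=> x y xA yA; case: (ltngtP x y) => [lt_xy|lt_yx|/val_inj->].
  - by rewrite ltnW // fA_lt.
  - by rewrite leqNgt fA_lt.
  - exact: leqnn.
have f_inj : {in A &, injective f}.
  move=> x y xA yA eq_f; apply: val_inj; apply/eqP.
  by rewrite eqn_leq -!fA_le // eq_f leqnn.
have e : n - size (gaps A) = m - size (gaps B).
  by rewrite !size_gaps // card_in_imset.
exists (gaps B), (gaps A), e => x.
have memB : (f x \in B) = (x \in A).
  apply/idP/idP => [fxB | xA]; last exact: imset_f.
  by rewrite inE; apply: contraNneq B0 => <-.
(* The rank of [x] in [A] is the rank of [f x] in [B], as [f] is increasing on
   [A]; off [A] both sides are 0. *)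
have -> : cast_ord (congr1 S e) (u_ (gaps A) x) = u_ (gaps B) (f x).
  apply: val_inj; rewrite /= !u_gapsE // memB; case: ifP => // xA.
  have <- : f @: [set y in A | y <= x] = [set z in B | z <= f x].
    apply/setP => z; rewrite inE; apply/imsetP/andP.
      by case=> y; rewrite inE => /andP[yA le_yx] ->; rewrite imset_f ?fA_le.
    case=> /imsetP[y yA ->]; rewrite fA_le // => le_yx.
    by exists y; rewrite // inE yA.
  rewrite card_in_imset // => y z; rewrite !inE => /andP[yA _] /andP[zA _].
  by apply: f_inj; rewrite inE.
rewrite u_K // mem_gaps memB inE negbK; apply/andP => -[fx_gt0 /eqP fx0].
by rewrite fx0 in fx_gt0.
Qed.
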